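(* Let $\mathscr{A}$ be a (not necessarily unital) complex $^*$-algebra and let $v,w$ be representable positive functionals on $\mathscr{A}$. If $w$ is $v$-absolutely continuous, then there exists a sequence $(a_n)_{n\in\mathbb{N}}$ in $\mathscr{A}$ such that $$w(a)=\lim_{n\to\infty}v(a_n^*a),\qquad a\in\mathscr{A}.$$ Moreover, the convergence is uniform on the set $\{a\in\mathscr{A}:w(a^*a)+v(a^*a)\leq1\}$.
   Context: A positive functional $v$ on $\mathscr{A}$ (a linear functional with $v(a^*a)\ge0$ for all $a$) is representable if there exist a Hilbert space $\mathfrak{H}_v$ with inner product $(\cdot\,|\,\cdot)_v$, a $^*$-representation $\pi_v$ of $\mathscr{A}$ into $\mathscr{B}(\mathfrak{H}_v)$ and a vector $\zeta_v\in\mathfrak{H}_v$ that is cyclic (i.e. $\{\pi_v(a)\zeta_v:a\in\mathscr{A}\}$ is dense in $\mathfrak{H}_v$) such that $v(a)=(\pi_v(a)\zeta_v\,|\,\zeta_v)_v$ for all $a\in\mathscr{A}$. $w$ is absolutely continuous with respect to $v$ ($v$-absolutely continuous) if for every sequence $(a_n)$ in $\mathscr{A}$, $v(a_n^*a_n)\to0$ and $w((a_n^*-a_m^* )(a_n-a_m))\to0$ (as $n,m\to\infty$) imply $w(a_n^*a_n)\to0$. *)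

(* Defs.v *)
From HB Require Import structures.
From mathcomp Require Import all_boot all_order all_algebra.
From mathcomp Require Import complex.
From mathcomp Require Import all_classical all_reals all_analysis.

Set Implicit Arguments.
Unset Strict Implicit.
Unset Printing Implicit Defensive.

Import Order.TTheory GRing.Theory Num.Theory numFieldNormedType.Exports.

Local Open Scope classical_set_scope.
Local Open Scope ring_scope.
Local Open Scope complex_scope.

(* MathComp-Analysis only equips R[i]^o with the topology of the modulus. *)
HB.instance Definition _ (R : realType) := NormedModule.copy R[i] R[i]^o.

(* The rings and algebras of the library are unital, so the product of a
   possibly non-unital algebra is a new operation on a left module. *)
HB.mixin Record Lmodule_isStarAlgebra (C : numClosedFieldType) A
    of GRing.Lmodule C A := {
  amul : A -> A -> A;
  star : A -> A;
  amulA : associative amul;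
  amulDl : left_distributive amul +%R;
  amulDr : right_distributive amul +%R;
  amulZl : forall (c : C) (a b : A), amul (c *: a) b = c *: amul a b;
  amulZr : forall (c : C) (a b : A), amul a (c *: b) = c *: amul a b;
  starK : involutive star;
  starD : {morph star : a b / a + b};
  starZ : forall (c : C) (a : A), star (c *: a) = Num.conj c *: star a;
  starM : forall a b : A, star (amul a b) = amul (star b) (star a)
}.

#[short(type="starAlgType")]
HB.structure Definition StarAlgebra (C : numClosedFieldType) :=
  {A of GRing.Lmodule C A & Lmodule_isStarAlgebra C A}.

Notation "a ** b" := (amul a b) (at level 40, left associativity) : ring_scope.

(* The form inner is linear in its first argument. *)
Record hilbertSpace (R : realType) := HilbertSpace {
  hilbert_sort :> completeNormedModType R[i];
  inner : {dot hilbert_sort for @Num.conj R[i]};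
  inner_norm : forall x : hilbert_sort, inner x x = `|x| ^+ 2
}.
Arguments inner {R} h.

Definition bounded_operator (R : realType) (H : hilbertSpace R) (T : H -> H) :=
  exists M : R, forall x : H, `|T x| <= M%:C * `|x|.

Record star_representation (R : realType) (A : starAlgType R[i])
    (H : hilbertSpace R) (pi : A -> {linear H -> H}) : Prop := {
  repr_bounded : forall a, bounded_operator (pi a);
  reprD : forall a b x, pi (a + b) x = pi a x + pi b x;
  reprZ : forall (c : R[i]) a x, pi (c *: a) x = c *: pi a x;
  reprM : forall a b x, pi (a ** b) x = pi a (pi b x);
  repr_star : forall a x y, inner H (pi a x) y = inner H x (pi (star a) y)
}.

Definition cyclic_vector (R : realType) (A : starAlgType R[i])
    (H : hilbertSpace R) (pi : A -> {linear H -> H}) (zeta : H) :=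
  dense (range (fun a => pi a zeta)).

Definition positive_functional (R : realType) (A : starAlgType R[i])
    (v : {scalar A}) := forall a, 0 <= v (star a ** a).

Definition representable (R : realType) (A : starAlgType R[i])
    (v : {scalar A}) :=
  exists (H : hilbertSpace R) (pi : A -> {linear H -> H}) (zeta : H),
    [/\ star_representation pi, cyclic_vector pi zeta
      & forall a, v a = inner H (pi a zeta) zeta].

Definition absolutely_continuous (R : realType) (A : starAlgType R[i])
    (w v : {scalar A}) :=
  forall a : nat -> A,
    v (star (a n) ** a n) @[n --> \oo] --> (0 : R[i]) ->
    w ((star (a p.1) - star (a p.2)) ** (a p.1 - a p.2))
      @[p --> (\oo, \oo)] --> (0 : R[i]) ->
    w (star (a n) ** a n) @[n --> \oo] --> (0 : R[i]).

(* Main.v *)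
Require Import Defs.
From HB Require Import structures.
From mathcomp Require Import all_boot all_order all_algebra.
From mathcomp Require Import complex ring lra.
From mathcomp Require Import all_classical all_reals all_analysis.

(* Write v(a^* b) = (S b | S a) and w(a^* b) = (T b | T a), w(b) = (T b | zeta).
   Let a_n minimize c ||S a||^2 + ||T a - zeta||^2, with c = n + 1, up to an
   error of 1 / c^2. As the infima increase with n and are bounded by
   ||zeta||^2, the parallelogram law makes (T a_n) a Cauchy sequence, while
   S a_n --> 0; absolute continuity then gives T a_n --> 0. Since a_n is almost
   a minimizer, c (S b | S a_n) + (T b | T a_n - zeta) is almost 0, uniformly
   for ||S b||^2 + ||T b||^2 <= 1, so that w(b) is the limit of
   c (S b | S a_n) = v((c a_n)^* b). *)

Set Implicit Arguments.
Unset Strict Implicit.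
Unset Printing Implicit Defensive.

Import Order.TTheory GRing.Theory Num.Theory numFieldNormedType.Exports.

Local Open Scope classical_set_scope.
Local Open Scope ring_scope.
Local Open Scope complex_scope.

Local Notation Re := (@complex.Re _).
Local Notation Im := (@complex.Im _).

(** * Squared moduli and squared norms as real numbers *)

Definition sqnormc (R : realType) (z : R[i]) : R := Re z ^+ 2 + Im z ^+ 2.

(** [inner H x x] is real by [innerxx], so [Re] loses nothing. *)
Definition sqnorm (R : realType) (H : hilbertSpace R) (x : H) : R :=
  Re (inner H x x).

Lemma sqnormcE (R : realType) (z : R[i]) : (sqnormc z)%:C = `|z| ^+ 2.
Proof. exact: add_Re2_Im2. Qed.

Lemma normc_ltP (R : realType) (z : R[i]) (e : R) :
  0 <= e -> (`|z| < e%:C) = (sqnormc z < e ^+ 2).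
Proof.
move=> e0; rewrite -ltcR sqnormcE rmorphXn /= ltr_pXn2r ?nnegrE ?normr_ge0 //.
by rewrite ler0c.
Qed.

(** Parallelogram law: the two sides differ by the squared modulus of [y + z]. *)
Lemma sqnormcB_le (R : realType) (y z : R[i]) :
  sqnormc (y - z) <= 2 * (sqnormc y + sqnormc z).
Proof. case: y z => [a b] [c d]; rewrite /sqnormc /=.
by have := sqr_ge0 (a + c); have := sqr_ge0 (b + d); lra. Qed.

(* Taking t to be a negative multiple of the conjugate of z minimizes the
   right-hand side. *)
Lemma sqnormc_le_of_quadratic (R : realType) (z : R[i]) (Q e M : R) :
  (forall t, 0 <= sqnormc t * Q + 2 * Re (t * z) + e) -> 0 < M -> Q <= M ->
  sqnormc z <= e * M.
Proof.
move=> tQ M0 QM.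
have := tQ ((- M^-1)%:C * z^*%C).
have -> : sqnormc ((- M^-1)%:C * z^*%C) = M^-1 ^+ 2 * sqnormc z.
  by case: z {tQ} => [a b]; rewrite /sqnormc /=; ring.
have -> : Re ((- M^-1)%:C * z^*%C * z) = - M^-1 * sqnormc z.
  by case: z {tQ} => [a b]; rewrite /sqnormc /=; ring.
have z0 : 0 <= sqnormc z by rewrite addr_ge0 ?sqr_ge0.
move=> le0; rewrite mulrC -ler_pdivrMl //.
(* By [Q <= M], the quadratic term offsets at most half of the negative linear one. *)
have : M^-1 ^+ 2 * sqnormc z * Q <= M^-1 * sqnormc z.
  rewrite -[leRHS]mulr1 -(mulVf (lt0r_neq0 M0)) expr2 -!mulrA.
  rewrite !ler_pM2l ?invr_gt0 // mulrCA ler_wpM2l //.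
  by rewrite ler_pM2l ?invr_gt0.
lra.
Qed.

(** * Parallelogram law and Cauchy-Schwarz inequality *)

Section Inner.
Variables (R : realType) (H : hilbertSpace R).
Implicit Types (x y : H).

Lemma innerxx x : inner H x x = (sqnorm x)%:C.
Proof.
have := exprn_ge0 2 (normr_ge0 x).
rewrite -inner_norm lecE => /andP[/eqP/= i0 _].
by rewrite /sqnorm; case: (inner H x x) i0 => a b /= ->.
Qed.

Lemma sqnorm_ge0 x : 0 <= sqnorm x.
Proof. by rewrite -ler0c -innerxx inner_norm exprn_ge0. Qed.

Lemma innerC x y : inner H y x = (inner H x y)^*%C.
Proof. by rewrite hermC expr0 mul1r. Qed.

Lemma sqnormDZ x y (t : R[i]) :
  sqnorm (x + t *: y) =
    sqnormc t * sqnorm y + 2 * Re (t * inner H y x) + sqnorm x.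
Proof.
rewrite /sqnorm linearDl !linearDr !linearZl_LR !linearZr_LR /=.
rewrite (innerC y x) !innerxx.
case: t (inner H y x) (sqnorm x) (sqnorm y) => [a b] [c d] e f.
by rewrite /sqnormc /=; ring.
Qed.

Lemma sqnorm0 : sqnorm (0 : H) = 0.
Proof. by rewrite /sqnorm linear0l. Qed.

Lemma sqnormN x : sqnorm (- x) = sqnorm x.
Proof. by rewrite /sqnorm hnormN. Qed.

(** Parallelogram law, with the midpoint isolated so that a lower bound there gives an upper bound
    on the distance. *)
Lemma sqnormB_midpoint x y :
  sqnorm (x - y) =
    2 * sqnorm x + 2 * sqnorm y - 4 * sqnorm (2^-1%:C *: (x + y)).
Proof.
have := sqnormDZ x y 1; have := sqnormDZ x y (-1).
have := sqnormDZ 0 (x + y) 2^-1%:C.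
rewrite add0r scale1r scaleN1r linear0r sqnorm0 mulr0 mul1r mulN1r raddfN.
by rewrite /sqnormc /= => -> -> ->; field.
Qed.

(** Cauchy-Schwarz; the positive bound [M] spares a separate case [y = 0]. *)
Lemma sqnormc_inner_le x y (M : R) : 0 < M -> sqnorm y <= M ->
  sqnormc (inner H y x) <= sqnorm x * M.
Proof.
apply: sqnormc_le_of_quadratic => t.
by rewrite -sqnormDZ sqnorm_ge0.
Qed.

End Inner.

(** * Near-minimizers of a penalized distance to [zeta] *)

Section Regularization.
Variables (R : realType) (A : lmodType R[i]) (H K : hilbertSpace R).
Variables (S : {linear A -> H}) (T : {linear A -> K}) (zeta : K).
Implicit Types (a b : A) (c e M : R).

Definition penalty c a : R := c * sqnorm (S a) + sqnorm (T a - zeta).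

Definition min_penalty c : R := inf (range (penalty c)).

Lemma penalty_ge0 c a : 0 <= c -> 0 <= penalty c a.
Proof. by move=> c0; rewrite addr_ge0 ?mulr_ge0 ?sqnorm_ge0. Qed.

Lemma penalty_has_inf c : 0 <= c -> has_inf (range (penalty c)).
Proof.
move=> c0; split; first by exists (penalty c 0), 0.
by exists 0 => _ [a _ <-]; exact: penalty_ge0.
Qed.

Lemma min_penalty_le c a : 0 <= c -> min_penalty c <= penalty c a.
Proof. by move=> /penalty_has_inf[_ ?]; apply: ge_inf => //; exists a. Qed.

(** Comparison with [a = 0]; the bound is the same for all [c]. *)
Lemma min_penalty_le_sqnorm c : 0 <= c -> min_penalty c <= sqnorm zeta.
Proof.
move=> /(@min_penalty_le c 0) /le_trans; apply.
by rewrite /penalty !raddf0 sub0r sqnormN sqnorm0 mulr0 add0r.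
Qed.

Lemma near_minimizer c e : 0 <= c -> 0 < e ->
  exists a, penalty c a < min_penalty c + e.
Proof.
move=> /penalty_has_inf + /inf_adherent => /[swap] /[apply] -[_ [a _ <-]].
by exists a.
Qed.

(** At an exact minimizer the derivative in each direction [b] vanishes; minimality up to [e]
    against all [a + t *: b] still bounds it, through a quadratic in [t]. *)
Lemma penalty_first_order c e M a b :
  1 <= c -> penalty c a < min_penalty c + e ->
  0 < M -> sqnorm (S b) + sqnorm (T b) <= M ->
  sqnormc (c%:C * inner H (S b) (S a) + inner K (T b) (T a - zeta))
    <= e * (c * M).
Proof.
move=> c1 ae M0 bM.
have c0 : 0 < c by exact: lt_le_trans c1.
apply: (@sqnormc_le_of_quadratic _ _ (c * sqnorm (S b) + sqnorm (T b))).
- move=> t.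
  have := min_penalty_le (a + t *: b) (ltW c0).
  have SE : S (a + t *: b) = S a + t *: S b by rewrite linearD linearZ.
  have TE : T (a + t *: b) - zeta = T a - zeta + t *: T b.
    by rewrite linearD linearZ addrAC.
  rewrite /penalty SE TE !sqnormDZ.
  move: ae; rewrite /penalty.
  case: t {SE TE} (inner H _ _) (inner K _ _) => [t1 t2] [x1 x2] [y1 y2].
  rewrite /sqnormc /=. lra.
- by rewrite mulr_gt0.
(* [1 <= c] absorbs [sqnorm (T b)] into [c * sqnorm (T b)]. *)
- apply: le_trans (ler_wpM2l (ltW c0) bM).
  by rewrite mulrDr lerD2l ler_peMl ?sqnorm_ge0.
Qed.

(** The parallelogram law applies to both terms of the penalty, which is at least [min_penalty c] at
    the midpoint; [c * sqnorm (S a - S a')] is dropped. *)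
Lemma sqnormB_near_minimizers c a a' : 0 <= c ->
  sqnorm (T a - T a') <= 2 * penalty c a + 2 * penalty c a' - 4 * min_penalty c.
Proof.
move=> c0; pose m := 2^-1%:C *: (a + a').
have /(ler_wpM2l (ler0n R 4)) := min_penalty_le m c0.
have SE := sqnormB_midpoint (S a) (S a').
have TE := sqnormB_midpoint (T a - zeta) (T a' - zeta).
have SM : S m = 2^-1%:C *: (S a + S a') by rewrite linearZ linearD.
have TM : T m - zeta = 2^-1%:C *: (T a - zeta + (T a' - zeta)).
  rewrite linearZ linearD addrACA [RHS]scalerDr -opprD -mulr2n.
  rewrite -[zeta *+ 2]scaler_nat scalerN scalerA -(rmorph_nat (real_complex R)) -rmorphM /=.
  by rewrite mulVf ?scale1r.
have -> : T a - T a' = T a - zeta - (T a' - zeta) by rewrite opprB addrA subrK.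
have := mulr_ge0 c0 (sqnorm_ge0 (S a - S a')).
by rewrite SE TE /penalty SM TM; lra.
Qed.

Lemma penalty_mono c c' a : c <= c' -> penalty c a <= penalty c' a.
Proof. by move=> cc'; rewrite lerD2r ler_wpM2r ?sqnorm_ge0. Qed.

(** The infima are bounded, so some [c_ N0] nearly reaches their supremum; all late [a_ k] are then
    almost minimal for this single weight. *)
Lemma near_minimizers_cauchy (c_ e_ : nat -> R) (a_ : nat -> A) :
  (forall n, 0 <= c_ n) -> {homo c_ : m n / (m <= n)%N >-> m <= n} ->
  e_ @ \oo --> 0 ->
  (forall n, penalty (c_ n) (a_ n) < min_penalty (c_ n) + e_ n) ->
  forall e, 0 < e -> exists N, forall m n, (N <= m)%N -> (N <= n)%N ->
    sqnorm (T (a_ m) - T (a_ n)) < e.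
Proof.
move=> c0 c_mono e_0 a_min e e0.
pose E := range (fun n => min_penalty (c_ n)).
have supE : has_sup E.
  split; first by exists (min_penalty (c_ 0)), 0%N.
  by exists (sqnorm zeta) => _ [n _ <-]; exact: min_penalty_le_sqnorm.
(* Two penalties with factor 2 and one infimum with factor 4 are each off by [e / 8]. *)
have e8 : 0 < e / 8 by rewrite divr_gt0.
have [_ [N0 _ <-] N0P] := sup_adherent e8 supE.
have /cvgrPdist_lt/(_ _ e8)[N1 _ N1P] := e_0.
exists (maxn N0 N1) => m n.
rewrite !geq_max => /andP[N0m N1m] /andP[N0n N1n].
apply: le_lt_trans (sqnormB_near_minimizers _ _ (c0 N0)) _.
have bnd k : (N0 <= k)%N -> (N1 <= k)%N ->
    penalty (c_ N0) (a_ k) < sup E + e / 8.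
  move=> N0k N1k; apply: le_lt_trans (penalty_mono _ (c_mono _ _ N0k)) _.
  apply: lt_trans (a_min k) _; apply: ler_ltD.
    by apply: sup_upper_bound => //; exists k.
  have := N1P _ N1k; rewrite /= sub0r normrN; apply: le_lt_trans.
  exact: ler_norm.
by have := bnd m N0m N1m; have := bnd n N0n N1n; lra.
Qed.

End Regularization.

(** * Convergence in [R[i]] through real quantities *)

Lemma cvg_real_complex0 (R : realType) (T : Type) (F : set_system T)
    (FF : Filter F) (f : T -> R) :
  (f x)%:C @[x --> F] --> (0 : R[i]) <-> f @ F --> (0 : R).
Proof.
have normC0 x : `|0 - (f x)%:C| = `|0 - f x|%:C.
  by rewrite !sub0r !normrN normc_def /= expr0n addr0 sqrtr_sqr.
split=> /cvgrPdist_lt f0; apply/cvgrPdist_lt.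
  move=> e e0; have /f0 : 0 < e%:C :> R[i] by rewrite ltcR.
  by apply: filterS => x; rewrite normC0 ltcR.
(* A positive element of [R[i]] has zero imaginary part. *)
move=> -[e ei]; rewrite ltcE /= => /andP[/eqP -> /f0].
by apply: filterS => x; rewrite normC0 ltcR.
Qed.

Lemma cvg_sqnormcP (R : realType) (T : Type) (F : set_system T)
    (FF : Filter F) (u : T -> R[i]) (l : R[i]) :
  u x @[x --> F] --> l <->
  (forall e : R, 0 < e -> \forall x \near F, sqnormc (l - u x) < e).
Proof.
split=> [/cvgrPdist_lt ul e e0|ul].
  have se0 : 0 < Num.sqrt e by rewrite sqrtr_gt0.
  have /ul : 0 < (Num.sqrt e)%:C :> R[i] by rewrite ltcR.
  by apply: filterS => x; rewrite normc_ltP ?sqr_sqrtr // ltW.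
apply/cvgrPdist_lt => -[e ei]; rewrite ltcE /= => /andP[/eqP -> e0].
have /ul : 0 < e ^+ 2 by rewrite exprn_gt0.
by apply: filterS => x; rewrite -normc_ltP // ltW.
Qed.

(** * Orbit maps of representable functionals *)

Lemma representable_orbit (R : realType) (A : starAlgType R[i])
    (v : {scalar A}) : representable v ->
  exists (H : hilbertSpace R) (T : {linear A -> H}) (zeta : H),
    (forall a b, v (star a ** b) = inner H (T b) (T a)) /\
    (forall a, v a = inner H (T a) zeta).
Proof.
move=> [H [pi [zeta [piR _ vE]]]].
have T_linear : linear (fun a => pi a zeta).
  by move=> c a b; rewrite (reprD piR) (reprZ piR).
pose T : {linear A -> H} :=
  HB.pack (fun a => pi a zeta) (GRing.isLinear.Build _ _ _ _ _ T_linear).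
exists H, T, zeta; split=> // a b.
(* [pi (star a)] moves to the other side of the inner product as [pi a]. *)
by rewrite vE (reprM piR) (repr_star piR) starK.
Qed.

Lemma starB (R : realType) (A : starAlgType R[i]) (a b : A) :
  star (a - b) = star a - star b.
Proof. by rewrite starD -scaleN1r starZ rmorphN rmorph1 scaleN1r. Qed.

(** * Rescaled near-minimizers as the approximating sequence *)

Theorem theorem5p1 (R : realType) (A : starAlgType R[i]) (v w : {scalar A})
    (v_pos : positive_functional v) (v_repr : representable v)
    (w_pos : positive_functional w) (w_repr : representable w)
    (wv : absolutely_continuous w v) :
  exists a_ : nat -> A,
    (forall a : A, v (star (a_ n) ** a) @[n --> \oo] --> w a) /\
    {uniform [set a : A | w (star a ** a) + v (star a ** a) <= 1],
      (fun n (a : A) => v (star (a_ n) ** a)) @ \oo --> (w : A -> R[i])}.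
Proof.
have [H [S [_ [vE _]]]] := representable_orbit v_repr.
have [K [T [zeta [wE wzeta]]]] := representable_orbit w_repr.
(* The exponent makes [e_ n * c_ n], the size of the first-order defect, tend to 0. *)
pose c_ n : R := n.+1%:R; pose e_ n : R := c_ n ^- 2.
have c_gt0 n : 0 < c_ n by rewrite ltr0Sn.
have c_ge0 n : 0 <= c_ n by exact: ltW.
have c_ge1 n : 1 <= c_ n by rewrite ler1n.
have e_gt0 n : 0 < e_ n by rewrite invr_gt0 exprn_gt0.
have cV_0 : (c_ n)^-1 @[n --> \oo] --> 0 by exact: cvg_harmonic.
have e_0 : e_ @ \oo --> 0.
  rewrite -[0](mulr0 0); under [e_]funext do rewrite /e_ expr2 invfM.
  exact: cvgM.
have /choice[a_ a_min] := fun n => near_minimizer S T zeta (c_ge0 n) (e_gt0 n).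
(* [c_ n * sqnorm (S (a_ n))] stays below [sqnorm zeta + e_ n], and [e_ n <= 1]. *)
have Sa_0 : sqnorm (S (a_ n)) @[n --> \oo] --> 0.
  apply: (@squeeze_cvgr _ _ _ _ (cst 0)
    (fun n => (sqnorm zeta + 1) * (c_ n)^-1)).
  - near=> n; rewrite sqnorm_ge0 /= ler_pdivlMr // mulrC.
    have := a_min n; rewrite /penalty.
    have := min_penalty_le_sqnorm S T zeta (c_ge0 n).
    have := sqnorm_ge0 (T (a_ n) - zeta).
    have : e_ n <= 1 by rewrite invf_le1 ?exprn_gt0 // exprn_ege1.
    lra.
  - exact: cvg_cst.
  - rewrite -[0](mulr0 (sqnorm zeta + 1)).
    by apply: cvgM cV_0; exact: cvg_cst.
have Ta_0 : sqnorm (T (a_ n)) @[n --> \oo] --> 0.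
  have c_mono : {homo c_ : m n / (m <= n)%N >-> m <= n}.
    by move=> m n mn; rewrite ler_nat.
  have vE' a : v (star a ** a) = (sqnorm (S a))%:C by rewrite vE innerxx.
  have wE' a : w (star a ** a) = (sqnorm (T a))%:C by rewrite wE innerxx.
  apply/cvg_real_complex0.
  under eq_fun do rewrite -wE'.
  (* The first premise is [Sa_0], the second the Cauchy property of [T (a_ n)]. *)
  apply: wv; first by under eq_fun do rewrite vE'; exact/cvg_real_complex0.
  under eq_fun do rewrite -starB wE' raddfB.
  apply/cvg_real_complex0/cvgrPdist_lt => e e0.
  have [N NP] := near_minimizers_cauchy c_ge0 c_mono e_0 a_min e0.
  exists ([set n | N <= n]%N, [set n | N <= n]%N); first by split; exists N.
  by move=> [m n] /= [Nm Nn]; rewrite sub0r normrN ger0_norm ?sqnorm_ge0 ?NP.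
have a_bound n b M : 0 < M -> sqnorm (S b) + sqnorm (T b) <= M ->
    sqnormc (w b - v (star ((c_ n)%:C *: a_ n) ** b)) <=
    2 * (sqnorm (T (a_ n)) + (c_ n)^-1) * M.
  move=> M0 bM.
  have TbM : sqnorm (T b) <= M by apply: le_trans bM; rewrite lerDr sqnorm_ge0.
  have Ta_le := sqnormc_inner_le (T (a_ n)) M0 TbM.
  have := penalty_first_order (c_ge1 n) (a_min n) M0 bM.
  have -> : e_ n * (c_ n * M) = (c_ n)^-1 * M.
    by rewrite mulrA /e_ expr2 invfM mulfVK // gt_eqF.
  set z := _ + _ => z_le.
  (* The error splits into a term small by [Ta_0] and the first-order defect [z]. *)
  have -> : w b - v (star ((c_ n)%:C *: a_ n) ** b) =
      inner K (T b) (T (a_ n)) - z.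
    rewrite wzeta vE linearZ linearZr_LR /= /z linearBr.
    have -> : Num.conj (c_ n)%:C = (c_ n)%:C :> R[i] by exact: conjc_real.
    ring.
  apply: le_trans (sqnormcB_le _ _) _.
  by rewrite -mulrA ler_pM2l // mulrDl lerD.
(* The bound depends on [b] only through [M], which gives uniformity. *)
have near_bound (e M : R) : 0 < e -> 0 < M -> \forall n \near \oo, forall b,
    sqnorm (S b) + sqnorm (T b) <= M ->
    sqnormc (w b - v (star ((c_ n)%:C *: a_ n) ** b)) < e.
  move=> e0 M0.
  have : 2 * (sqnorm (T (a_ n)) + (c_ n)^-1) * M @[n --> \oo] --> 0.
    have -> : 0 = 2 * (0 + 0) * M by ring.
    apply: cvgM; last exact: cvg_cst.
    by apply: cvgM; [exact: cvg_cst | exact: cvgD].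
  move=> /cvgrPdist_lt/(_ _ e0); apply: filterS => n.
  rewrite sub0r normrN => /(le_lt_trans (ler_norm _)) ne b bM.
  exact: le_lt_trans (a_bound _ _ _ M0 bM) ne.
exists (fun n => (c_ n)%:C *: a_ n); split=> [b|].
  (* Adding 1 keeps [M] positive even if [S b] and [T b] vanish. *)
  apply/cvg_sqnormcP => e e0; pose M := sqnorm (S b) + sqnorm (T b) + 1.
  have M0 : 0 < M by rewrite ltr_wpDl ?addr_ge0 ?sqnorm_ge0.
  have := near_bound _ _ e0 M0; apply: filterS => n; apply.
  by rewrite lerDl.
move=> P /uniform_nbhs[E [entE EP]].
move: entE; rewrite -entourage_ballE => -[[e ei]].
rewrite /= ltcE => /andP[/eqP /= -> e0] eE.
(* On the given set [M = 1] serves all elements at once. *)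
have := near_bound _ 1 (exprn_gt0 2 e0) ltr01; apply: filterS => n nb.
apply: EP => b /= b1; apply: eE; rewrite /= -ball_normE /= normc_ltP ?ltW //.
apply: nb.
by rewrite -lecR rmorphD /= -!innerxx -vE -wE addrC.
Unshelve. all: by end_near.
Qed.
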